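(* Let $f:\mathbb{R}^n\times\mathbb{R}^q\to\mathbb{R}^n$ be locally Lipschitz and consider the dynamical system $\dot{x}=f(x,w)$ with disturbance set $[\underline{w},\overline{w}]\subset\mathbb{R}^q$ and initial set $[\underline{x}_0,\overline{x}_0]\subset\mathbb{R}^n$, where $\underline{w}\le\overline{w}$ and $\underline{x}_0\le\overline{x}_0$. Let $\mathsf{F}=\begin{bmatrix}\underline{\mathsf{F}}\\ \overline{\mathsf{F}}\end{bmatrix}:\mathcal{T}^{2n}_{\ge0}\times\mathcal{T}^{2q}_{\ge0}\to\mathcal{T}^{2n}_{\ge0}$ be an inclusion function for $f$. Let $t\mapsto(\underline{x}(t),\overline{x}(t))$ be the trajectory, starting from $(\underline{x}_0,\overline{x}_0)$ with fixed disturbance $(w,\widehat{w})=(\underline{w},\overline{w})$, of the embedding system $$\dot{x}_i=\underline{\mathsf{F}}_i(x,\widehat{x}_{[i:x]},w,\widehat{w}),\qquad \dot{\widehat{x}}_i=\overline{\mathsf{F}}_i(x_{[i:\widehat{x}]},\widehat{x},w,\widehat{w}),\qquad i\in\{1,\dots,n\},$$ and let $t\mapsto(\underline{x}^{\min}(t),\overline{x}^{\min}(t))$ be the trajectory, with the same initial condition and the same fixed disturbance, of the embedding system $$\dot{x}_i=\min_{\substack{z\in[x,\widehat{x}],\,z_i=x_i\\ v\in[w,\widehat{w}]}}f_i(z,v),\qquad \dot{\widehat{x}}_i=\max_{\substack{z\in[x,\widehat{x}],\,z_i=\widehat{x}_i\\ v\in[w,\widehat{w}]}}f_i(z,v),\qquad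 i\in\{1,\dots,n\},$$ both trajectories being assumed to exist (in $\mathcal{T}^{2n}_{\ge0}$) for all $t\ge0$. Then, for every $t\ge0$, $$\mathcal{R}_f(t,[\underline{x}_0,\overline{x}_0],[\underline{w},\overline{w}])\subseteq[\underline{x}^{\min}(t),\overline{x}^{\min}(t)]\subseteq[\underline{x}(t),\overline{x}(t)].$$
   Context: Inequalities between vectors are componentwise; $[x,\widehat{x}]=\{z: x\le z\le\widehat{x}\}$; $\mathcal{T}^{2n}_{\ge0}=\{(x,\widehat{x})\in\mathbb{R}^{2n}: x\le\widehat{x}\}$. For $v,w\in\mathbb{R}^n$ and an index $i$, $v_{[i:w]}$ is the vector obtained from $v$ by replacing its $i$th entry by $w_i$. $\mathsf{F}$ is an inclusion function for $f$ if $\underline{\mathsf{F}}(x,\widehat{x},w,\widehat{w})\le f(z,v)\le\overline{\mathsf{F}}(x,\widehat{x},w,\widehat{w})$ for all $x\le\widehat{x}$, $w\le\widehat{w}$, $z\in[x,\widehat{x}]$, $v\in[w,\widehat{w}]$. For sets $\mathcal{X}\subseteq\mathbb{R}^n$ and $\mathcal{W}\subseteq\mathbb{R}^q$, the reachable set $\mathcal{R}_f(t,\mathcal{X},\mathcal{W})$ is the set of all values at time $t$ of solutions of $\dot{x}=f(x,w(t))$ starting at time $0$ from some $x_0\in\mathcal{X}$ with some piecewise continuous disturbance $w:\mathbb{R}_{\ge0}\to\mathcal{W}$. *)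

(* Defs.v *)
From mathcomp Require Export all_boot all_order all_algebra.
From mathcomp Require Export all_classical all_reals all_analysis.
Export numFieldNormedType.Exports.

Set Implicit Arguments.
Unset Strict Implicit.
Unset Printing Implicit Defensive.

Import Order.TTheory GRing.Theory Num.Theory.


Local Open Scope classical_set_scope.
Local Open Scope ring_scope.

Section Vectors.
Variable R : realType.

Definition vle n (x y : 'rV[R]_n) : Prop := forall i : 'I_n, x 0 i <= y 0 i.

Definition box n (a b : 'rV[R]_n) : set 'rV[R]_n :=
  [set z | vle a z /\ vle z b].

Definition Tge0 n : set ('rV[R]_n * 'rV[R]_n) := [set p | vle p.1 p.2].

(* v_[i:w] *)
Definition replace_entry n (v : 'rV[R]_n) (i : 'I_n) (w : 'rV[R]_n) :
    'rV[R]_n :=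
  \row_j (if j == i then w 0 j else v 0 j).

(* The least (greatest) element of A; the default value 0 is only taken when
   A has no such element. *)
Definition set_min (A : set R) : R := xget 0 (A `&` lbound A).
Definition set_max (A : set R) : R := xget 0 (A `&` ubound A).

End Vectors.

Section Dynamics.
Variable R : realType.

(* Finitely many discontinuities in each bounded interval, with finite
   one-sided limits everywhere.  Values at negative times are irrelevant. *)
Definition piecewise_continuous (V : topologicalType) (w : R -> V) : Prop :=
  [/\ forall T : R, exists S : seq R,
        forall t, 0 < t < T -> t \notin S -> {for t, continuous w},
      forall t : R, 0 < t -> exists l : V, w @ t^'- --> l
    & forall t : R, 0 <= t -> exists l : V, w @ t^'+ --> l].

(* x solves x'(t) = g t (x t) on [0, T].  A finite set of exceptional times is
   allowed because the right-hand side may jump with the disturbance;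
   continuity of x still makes it determined by its derivative. *)
Definition solution_on (V : normedModType R) (T : R) (g : R -> V -> V)
    (x : R -> V) : Prop :=
  {within `[0, T], continuous x} /\
  exists S : seq R,
    forall t, 0 < t < T -> t \notin S -> is_derive t 1 x (g t (x t)).

Definition trajectory (V : normedModType R) (g : V -> V) (x0 : V)
    (x : R -> V) : Prop :=
  x 0 = x0 /\ forall T, 0 <= T -> solution_on T (fun=> g) x.

(* Only existence on [0, t] is required of the solutions. *)
Definition reachable n q (f : 'rV[R]_n -> 'rV[R]_q -> 'rV[R]_n) (t : R)
    (X : set 'rV[R]_n) (W : set 'rV[R]_q) : set 'rV[R]_n :=
  [set y | exists (x : R -> 'rV[R]_n) (w : R -> 'rV[R]_q),
    [/\ X (x 0), piecewise_continuous w, forall s, 0 <= s -> W (w s),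
        solution_on t (fun s z => f z (w s)) x & y = x t]].

End Dynamics.

Section Embedding.
Variables (R : realType) (n q : nat).

(* F is a total function, but only its values on Tge0 x Tge0 are constrained
   or used. *)
Definition inclusion_function
    (F : 'rV[R]_n * 'rV[R]_n -> 'rV[R]_q * 'rV[R]_q -> 'rV[R]_n * 'rV[R]_n)
    (f : 'rV[R]_n -> 'rV[R]_q -> 'rV[R]_n) : Prop :=
  forall (x x' : 'rV[R]_n) (w w' : 'rV[R]_q), vle x x' -> vle w w' ->
  forall z v, box x x' z -> box w w' v ->
    vle (F (x, x') (w, w')).1 (f z v) /\ vle (f z v) (F (x, x') (w, w')).2.

Definition embedding_field
    (F : 'rV[R]_n * 'rV[R]_n -> 'rV[R]_q * 'rV[R]_q -> 'rV[R]_n * 'rV[R]_n)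
    (w w' : 'rV[R]_q) (p : 'rV[R]_n * 'rV[R]_n) : 'rV[R]_n * 'rV[R]_n :=
  let: (x, x') := p in
  (\row_i (F (x, replace_entry x' i x) (w, w')).1 0 i,
   \row_i (F (replace_entry x i x', x') (w, w')).2 0 i).

Definition minmax_embedding_field (f : 'rV[R]_n -> 'rV[R]_q -> 'rV[R]_n)
    (w w' : 'rV[R]_q) (p : 'rV[R]_n * 'rV[R]_n) : 'rV[R]_n * 'rV[R]_n :=
  let: (x, x') := p in
  (\row_i set_min [set y | exists z v,
     [/\ box x x' z, z 0 i = x 0 i, box w w' v & y = f z v 0 i]],
   \row_i set_max [set y | exists z v,
     [/\ box x x' z, z 0 i = x' 0 i, box w w' v & y = f z v 0 i]]).

End Embedding.

(* Main.v *)
From HB Require Import structures.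
Require Import Defs.
From mathcomp Require Import lra ring.

Import Order.TTheory GRing.Theory Num.Theory.
Local Open Scope classical_set_scope.
Local Open Scope ring_scope.

Set Implicit Arguments.
Unset Strict Implicit.
Unset Printing Implicit Defensive.

(* Both inclusions are instances of one comparison principle between two
   box-valued curves P and Q.  Say that P moves outward if each of its faces has
   a velocity dominated by all values of f on that face, and that Q moves inward
   if the velocity of each of its faces dominates some value of f on that face.
   If Q(0) is contained in P(0), then Q(t) stays in P(t): when Q sticks out of P
   by at most d, clamping the point of Q's face that realizes its velocity onto
   P's face moves it by at most d, so the excess grows at rate at most L d, where
   L is a Lipschitz constant of f on a compact set containing everything.  The
   min-max embedding trajectory moves both outward and inward, the trajectory of
   any inclusion function moves outward, and a degenerate box {x(t)} following a
   solution moves inward. *)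

(** * Lipschitz bounds, continuity and differentiation *)

(* The library's local Lipschitz condition is a bound near every pair (x, y), not
   only near the diagonal: covering K `*` K gives a global constant without any
   convexity of K. *)
Lemma lipschitz_compact (R : realType) (V W : normedModType R) (g : V -> W)
    (K : set V) :
  [locally [lipschitz g u | u in [set: V]]] -> compact K ->
  exists2 L : R, 0 <= L &
    forall x y, K x -> K y -> `|g x - g y| <= L * `|x - y|.
Proof.
move=> lipg cK.
have /compact_near_coveringP cKK := compact_setX cK cK.
have [] := cKK R (+oo : set_system R)
  (fun M u => `|g u.1 - g u.2| <= M * `|u.1 - u.2|) _ _.
  move=> u _; have /(_ u) := lipg; move=> /(_ (conj I I)) [M0 [_ lipM0]].
  have /lipM0 : M0 < M0 + 1 by rewrite ltrDl.
  rewrite /dominated_by /self_sub /within /= => nu.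
  exists ([set v | `|g v.1 - g v.2| <= (M0 + 1) * `|v.1 - v.2|],
          [set M | M0 + 1 <= M]) => /=.
    split; last by apply: nbhs_pinfty_ge; rewrite num_real.
    by apply: filterS nu => v; apply; split.
  move=> [v M] [/= lv le_M]; apply: le_trans lv _.
  by apply: ler_wpM2r.
move=> M [_ lipM]; exists (`|M| + 1); first by rewrite addr_ge0.
move=> x y Kx Ky; apply: (lipM (`|M| + 1) _ (x, y)) => //.
by rewrite (le_lt_trans (ler_norm M))// ltrDl.
Qed.

(** The bound available near the diagonal pair [(x, x)] covers the pairs [(x, y)] with [y] close to
    [x]. *)
Lemma locally_lipschitz_continuous (R : realType) (V W : normedModType R)
    (g : V -> W) :
  [locally [lipschitz g u | u in [set: V]]] -> continuous g.
Proof.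
move=> lipg x; have := lipg (x, x) (conj I I) => -[M0 [_ lipM0]].
pose M := `|M0| + 1.
have M_gt0 : 0 < M by rewrite ltr_wpDl.
have /lipM0 : M0 < M by rewrite (le_lt_trans (ler_norm M0))// ltrDl.
rewrite /dominated_by /self_sub /within /= => -[[A B]] /= [nA nB] AB.
apply/cvgrPdist_le => e e_gt0; near=> y.
apply: (@le_trans _ _ (M * `|x - y|)).
  apply: (AB (x, y)) => //=; split; first exact: nbhs_singleton nA.
  by near: y.
rewrite -ler_pdivlMl//; near: y; apply: cvgr_dist_le => //.
by rewrite mulr_gt0// invr_gt0.
Unshelve. all: by end_near. Qed.

(** Difference quotients commute with linear maps, and continuity passes to the limit. This serves
    both the coordinates of box corners and the diagonal embedding of a solution. *)
Lemma is_derive_linear (R : realType) (V W : normedModType R) (l : V -> W)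
    (x : R -> V) (t : R) (v : V) :
  linear l -> continuous l -> is_derive t 1 x v ->
  is_derive t 1 (l \o x) (l v).
Proof.
move=> lin_l cont_l dx.
pose L : {linear V -> W} := HB.pack l (GRing.isLinear.Build _ _ _ _ l lin_l).
have cvgl : h^-1 *: (((l \o x) \o shift t) (h *: 1) - (l \o x) t)
    @[h --> 0^'] --> l v.
  rewrite (_ : (fun h => _) =
      l \o (fun h => h^-1 *: ((x \o shift t) (h *: 1) - x t))).
    apply: continuous_cvg; first exact: cont_l.
    rewrite -(@derive_val _ _ _ _ _ _ _ dx).
    exact: (@ex_derive _ _ _ _ _ _ _ dx).
  apply/funext => h /=.
  by rewrite -[l]/(L : V -> W) linearZ_LR [X in _ = _ *: X]linearB.
split; first by apply/cvg_ex; exists (l v).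
exact: cvg_lim cvgl.
Qed.

Lemma within_bounded (R : realType) (V : normedModType R) (T : R) (x : R -> V) :
  {within `[0, T], continuous x} ->
  exists2 B : R, 0 <= B & forall t, 0 <= t <= T -> `|x t| <= B.
Proof.
move=> cont_x.
have := compact_bounded (continuous_compact cont_x (@segment_compact R 0 T)).
move=> [M [_ xM]]; exists (`|M| + 1); first by rewrite addr_ge0.
move=> t tT; apply: (xM (`|M| + 1)).
  by rewrite (le_lt_trans (ler_norm M))// ltrDl.
by exists t; rewrite //= in_itv.
Qed.

(** * A maximum principle for finite families of scalar functions *)

Lemma near_left_notin (R : realType) (b : R) (S : seq R) :
  \forall t \near b^'-, t \notin S.
Proof.
elim: S => [|s S IHS]; first exact: nearW.
suff : \forall t \near b^'-, t != s.
  move=> ts; near=> t; rewrite in_cons negb_or; apply/andP; split; near: t.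
    exact: ts.
  exact: IHS.
have [bs|sb] := leP b s.
  apply: filterS (nbhs_left_lt b) => t tb.
  by rewrite lt_eqF// (lt_le_trans tb bs).
by apply: filterS (nbhs_left_gt sb) => t st; rewrite gt_eqF.
Unshelve. all: by end_near. Qed.

(* Weighting by expR (- K t) with K > 2 L makes a positive maximum of the
   family impossible: to the left of the point where it is attained, the
   weighted function strictly decreases. *)
Lemma le0_family (R : realType) (I : finType) (g dg : I -> R -> R)
    (T L : R) (S : seq R) :
  0 <= L ->
  (forall i, {within `[0, T], continuous (g i)}) ->
  (forall i, g i 0 <= 0) ->
  (forall i (t : R), 0 < t < T -> t \notin S -> is_derive t 1 (g i) (dg i t)) ->
  (forall i (t : R) d, 0 < t < T -> t \notin S -> (forall j, g j t <= d) ->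
    0 < g i t -> dg i t <= L * d) ->
  forall i (t : R), 0 <= t <= T -> g i t <= 0.
Proof.
move=> L_ge0 cont_g g0 der_g dg_le i0 t0 t0T; rewrite leNgt; apply/negP => git0.
have T_ge0 : 0 <= T by case/andP: t0T; exact: le_trans.
pose K := 2 * L + 1.
pose e (t : R) := expR (- K * t).
have e_gt0 (t : R) : 0 < e t by exact: expR_gt0.
have de (t : R) : is_derive t 1 e (- K * e t).
  rewrite /e; apply: is_derive_eq; rewrite /GRing.scale /= mulr1 mulrC//.
pose u i (t : R) := e t * g i t.
have cont_u i : {within `[0, T], continuous (u i)}.
  move=> t; apply: continuousM; last exact: cont_g.
  apply: continuous_subspaceT => s.
  apply: differentiable_continuous; apply/derivable1_diffP.
  exact: ex_derive.
pose c i := sval (cid2 (EVT_max T_ge0 (cont_u i))).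
have c_itv i : c i \in `[0, T] by rewrite /c; case: cid2.
have c_max i (t : R) : 0 <= t <= T -> u i t <= u i (c i).
  by move=> tT; rewrite /c; case: cid2 => /= x _; apply; rewrite in_itv.
(* The index is maximized as well as the time, so that the resulting value bounds every weighted
   member at every time. *)
pose k := [arg max_(i > i0) u i (c i)]%O.
have u_le i (t : R) : 0 <= t <= T -> u i t <= u k (c k).
  move=> /c_max/le_trans; apply; rewrite /k.
  by case: Order.TotalTheory.arg_maxP => // j _; exact.
set m := u k (c k) in u_le.
have m_gt0 : 0 < m by apply: lt_le_trans (u_le i0 t0 t0T); rewrite mulr_gt0.
have [/andP[ck_ge0 ck_le]] : 0 <= c k <= T by have := c_itv k; rewrite in_itv.
have ck_gt0 : 0 < c k.
  rewrite lt_neqAle ck_ge0 andbT; apply/eqP => ck0.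
  move: m_gt0; rewrite /m -ck0 ltNge /u => /negP; apply.
  by rewrite pmulr_rle0.
have cont_uk a : 0 <= a -> {within `[a, c k], continuous (u k)}.
  move=> a_ge0; apply: continuous_subspaceW (cont_u k) => s.
  rewrite /= !in_itv/= => /andP[as_ sc].
  by rewrite (le_trans a_ge0 as_) (le_trans sc ck_le).
have [_ _ left_c] := (continuous_within_itvP (u k) ck_gt0).1 (cont_uk 0 (lexx 0)).
(* The maximum point [c k] may be [T] or an exceptional time, so derivatives are taken only strictly
   to its left, where [u k] is still above half the maximum. *)
have : \forall t \near (c k)^'-, [/\ 0 < t, t \notin S & m / 2 < u k t].
  near=> t; split.
  - by near: t; exact: nbhs_left_gt.
  - by near: t; exact: near_left_notin.
  - near: t; apply: (cvgr_gt _ left_c).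
    by rewrite -/m ltr_pdivrMr// ltr_pMr// ltr1n.
move=> [d /= d_gt0 near_ck].
pose a := Num.max 0 (c k - d / 2).
have a_lt : a < c k by rewrite gt_max ck_gt0/= ltrBlDr ltrDl divr_gt0.
have near_ak (t : R) : a < t < c k -> [/\ 0 < t, t \notin S & m / 2 < u k t].
  rewrite gt_max => /andP[/andP[_ t_gt] t_lt]; apply: near_ck => //=.
  rewrite ger0_norm ?subr_ge0 ?(ltW t_lt)//.
  by rewrite ltrBlDr -ltrBlDl (lt_trans _ t_gt)// ltrD2l ltrN2
    ltr_pdivrMr// ltr_pMr// ltr1n.
have du (t : R) : t \in `]a, c k[ ->
    is_derive t 1 (u k) (e t * (dg k t - K * g k t)).
  rewrite in_itv/= => t_itv; have [t_gt0 tS _] := near_ak _ t_itv.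
  have /andP[_ /lt_le_trans/(_ ck_le) t_ltT] := t_itv.
  have dgt := der_g k t; rewrite t_gt0 t_ltT in dgt.
  have {}dgt := dgt isT tS.
  rewrite /u; apply: is_derive_eq.
  by rewrite /GRing.scale /=; ring.
have a_ge0 : 0 <= a by rewrite le_max lexx.
have ck_a : u k (c k) < u k a.
  apply: (@ltr0_derive1_lt_cc _ _ a (c k)) => //.
  - by move=> t /du dut; exact: ex_derive.
  - move=> t t_itv; have dut := du _ t_itv; rewrite derive1E derive_val.
    move: t_itv; rewrite in_itv/= => t_itv.
    have [t_gt0 tS ut_gt] := near_ak _ t_itv.
    have t_ltT : t < T by case/andP: t_itv => _ /lt_le_trans; exact.
    (* Undoing the weight at time [t]: [b] bounds all members while [g k t] exceeds [b / 2]. Hence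
       [dg k t <= L * b <= 2 * L * g k t < K * g k t], which explains the factor 2 in [K]. *)
    pose b := m / e t.
    have b_gt0 : 0 < b by rewrite divr_gt0.
    have gj_le j : g j t <= b.
      rewrite ler_pdivlMr// mulrC; apply: u_le.
      by rewrite (ltW t_gt0) (ltW t_ltT).
    have gk_gt : b / 2 < g k t.
      by rewrite /b mulrAC ltr_pdivrMr// [ltRHS]mulrC.
    have gk_gt0 : 0 < g k t by rewrite (lt_trans _ gk_gt)// divr_gt0.
    have dgk : dg k t <= L * b by apply: dg_le => //; rewrite t_gt0.
    rewrite pmulr_rlt0// subr_lt0 (le_lt_trans dgk)// /K.
    have : 0 <= L * (g k t - b / 2) by rewrite mulr_ge0// subr_ge0 ltW.
    lra.
  - exact: cont_uk.
  - by rewrite in_itv/= lexx ltW.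
  - by rewrite in_itv/= lexx ltW.
move: ck_a; rewrite ltNge => /negP; apply.
by apply: u_le; rewrite a_ge0 (le_trans (ltW a_lt)).
Unshelve. all: by end_near. Qed.

(** * Boxes, their faces and clamping *)

Section Boxes.
Variable R : realType.

Lemma coord_le_norm n (v : 'rV[R]_n) i : `|v 0 i| <= `|v|.
Proof.
rewrite [leRHS]/Num.Def.normr/= mx_normrE.
exact: (le_bigmax _ (fun ij => `|v ij.1 ij.2|) (0, i)).
Qed.

Lemma norm_le_coord n (v : 'rV[R]_n) d :
  0 <= d -> (forall i, `|v 0 i| <= d) -> `|v| <= d.
Proof.
move=> d_ge0 v_le; rewrite [leLHS]/Num.Def.normr/= mx_normrE.
by apply: bigmax_le => // -[i j] _; rewrite ord1.
Qed.

Lemma box_compact n (a b : 'rV[R]_n) : compact (box a b).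
Proof.
have := @rV_compact R n (fun i => `[a 0 i, b 0 i]%classic)
  (fun i => @segment_compact R (a 0 i) (b 0 i)).
congr compact; apply/seteqP; split => z /=.
  by move=> zab; split=> i; have := zab i; rewrite in_itv/= => /andP[].
by move=> [az zb] i; rewrite in_itv/= az zb.
Qed.

(** A face of a box is itself a box. This identifies the constraint set of the min-max field with
    the box at which [embedding_field] evaluates [F], and gives its compactness. *)
Lemma box_replace_r n (a b z : 'rV[R]_n) i : vle a b ->
  box a (replace_entry b i a) z <-> box a b z /\ z 0 i = a 0 i.
Proof.
move=> ab; split=> [[az zb]|[[az zb] zi]].
  have zia : z 0 i = a 0 i.
    by apply: le_anti; rewrite az; have := zb i; rewrite mxE eqxx => ->.
  split=> //; split=> // j; have := zb j; rewrite mxE.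
  by case: eqP => // -> _; rewrite zia.
split=> // j; rewrite mxE; case: eqP => // ->; by rewrite zi.
Qed.

Lemma box_replace_l n (a b z : 'rV[R]_n) i : vle a b ->
  box (replace_entry a i b) b z <-> box a b z /\ z 0 i = b 0 i.
Proof.
move=> ab; split=> [[az zb]|[[az zb] zi]].
  have zib : z 0 i = b 0 i.
    by apply: le_anti; rewrite zb; have := az i; rewrite mxE eqxx => ->.
  split=> //; split=> // j; have := az j; rewrite mxE.
  by case: eqP => // -> _; rewrite zib.
split=> // j; rewrite mxE; case: eqP => // ->; by rewrite zi.
Qed.

(** Clamp coordinatewise: each coordinate moves by at most the excess of the second box over the
    first, and the norm is the maximum over coordinates. A coordinate at or beyond a bound lands on
    it, so protruding faces are carried to faces. *)
Lemma clamp_box n (a b a' b' y : 'rV[R]_n) d : 0 <= d ->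
  vle a b -> box a' b' y ->
  (forall j, a 0 j - a' 0 j <= d) -> (forall j, b' 0 j - b 0 j <= d) ->
  exists z, [/\ box a b z, `|z - y| <= d,
    forall i, y 0 i <= a 0 i -> z 0 i = a 0 i &
    forall i, b 0 i <= y 0 i -> z 0 i = b 0 i].
Proof.
move=> d_ge0 ab [ay yb] ad bd.
exists (\row_j Num.max (a 0 j) (Num.min (y 0 j) (b 0 j))).
have zE j : [\/ a 0 j <= y 0 j <= b 0 j /\
                Num.max (a 0 j) (Num.min (y 0 j) (b 0 j)) = y 0 j,
    y 0 j <= a 0 j /\ Num.max (a 0 j) (Num.min (y 0 j) (b 0 j)) = a 0 j |
    b 0 j <= y 0 j /\ Num.max (a 0 j) (Num.min (y 0 j) (b 0 j)) = b 0 j].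
  have abj := ab j.
  have [yb_j|/ltW by_j] := leP (y 0 j) (b 0 j).
    have [ay_j|/ltW ya_j] := leP (a 0 j) (y 0 j).
      by apply: Or31.
    by apply: Or32.
  by rewrite (max_r abj); apply: Or33.
split.
- by split=> j; rewrite mxE; have abj := ab j; case: (zE j) => -[? ->]; lra.
- apply: norm_le_coord => // j; rewrite !mxE ler_norml.
  have ayj := ay j; have ybj := yb j; have adj := ad j; have bdj := bd j.
  by case: (zE j) => -[? ->]; lra.
- by move=> i ?; rewrite mxE; have abi := ab i; case: (zE i) => -[? ->]; lra.
- by move=> i ?; rewrite mxE; have abi := ab i; case: (zE i) => -[? ->]; lra.
Qed.

End Boxes.

(** * Comparison of box-valued curves *)

Section Comparison.
Variables (R : realType) (n q : nat) (f : 'rV[R]_n -> 'rV[R]_q -> 'rV[R]_n).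
Variables (wl wu : 'rV[R]_q).
Hypothesis hf :
  [locally [lipschitz (f u.1 u.2) | u in [set: 'rV[R]_n * 'rV[R]_q]]].

(* p = (lower corner, upper corner) of a box, v = its velocity. *)
Definition outer_velocity (p v : 'rV[R]_n * 'rV[R]_n) : Prop :=
  forall z u i, box p.1 p.2 z -> box wl wu u ->
    (z 0 i = p.1 0 i -> v.1 0 i <= f z u 0 i) /\
    (z 0 i = p.2 0 i -> f z u 0 i <= v.2 0 i).

Definition inner_velocity (p v : 'rV[R]_n * 'rV[R]_n) : Prop :=
  forall i,
    (exists z u, [/\ box p.1 p.2 z, box wl wu u, z 0 i = p.1 0 i &
      f z u 0 i <= v.1 0 i]) /\
    (exists z u, [/\ box p.1 p.2 z, box wl wu u, z 0 i = p.2 0 i &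
      v.2 0 i <= f z u 0 i]).

(** The bound [d] concerns the gaps of all coordinates because clamping the point that realizes [v']
    may move every coordinate. Positivity of the gap at [i] puts the clamped point on the matching
    face of [p], where [outer_velocity] applies with the same disturbance. *)
Lemma gap_velocity_le (B L d : R) (p p' v v' : 'rV[R]_n * 'rV[R]_n) :
  let K := box (const_mx (- B)) (const_mx B) `*` box wl wu in
  (forall x y, K x -> K y ->
    `|f x.1 x.2 - f y.1 y.2| <= L * `|x - y|) ->
  0 <= L -> 0 <= d ->
  Tge0 p -> outer_velocity p v -> inner_velocity p' v' ->
  `|p| <= B -> `|p'| <= B ->
  (forall i, p.1 0 i - p'.1 0 i <= d) -> (forall i, p'.2 0 i - p.2 0 i <= d) ->
  forall i,
    (0 < p.1 0 i - p'.1 0 i -> v.1 0 i - v'.1 0 i <= L * d) /\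
    (0 < p'.2 0 i - p.2 0 i -> v'.2 0 i - v.2 0 i <= L * d).
Proof.
move=> K lipL L_ge0 d_ge0 p_ge0 outer_v inner_v' pB p'B gap1 gap2 i.
have boxB (r : 'rV[R]_n * 'rV[R]_n) z : `|r| <= B -> box r.1 r.2 z ->
    box (const_mx (- B)) (const_mx B) z.
  rewrite prod_normE ge_max => /andP[r1 r2] [lez zle]; split=> j; rewrite mxE.
    have := le_trans (coord_le_norm r.1 j) r1; rewrite ler_norml => /andP[+ _].
    by move=> /le_trans; apply.
  have := le_trans (coord_le_norm r.2 j) r2; rewrite ler_norml => /andP[_ +].
  exact: le_trans.
have lip_le z y u : box p.1 p.2 z -> box p'.1 p'.2 y -> box wl wu u ->
    `|z - y| <= d -> `|f z u 0 i - f y u 0 i| <= L * d.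
  move=> /boxB-/(_ pB) zB /boxB-/(_ p'B) yB wu_u zy.
  have -> : f z u 0 i - f y u 0 i = (f z u - f y u) 0 i by rewrite !mxE.
  apply: le_trans (coord_le_norm _ _) _.
  apply: le_trans (lipL (z, u) (y, u) _ _) _ => //=.
  by rewrite ler_wpM2l// prod_normE/= subrr normr0 ge_max zy.
have [[y [u [yp' wu_u yi le_v']]] [y2 [u2 [y2p' wu_u2 y2i ge_v']]]] := inner_v' i.
split=> gap_gt0.
  have [z [zp zy zl _]] := clamp_box d_ge0 p_ge0 yp' gap1 gap2.
  have zi : z 0 i = p.1 0 i by apply: zl; rewrite yi; lra.
  have [/(_ zi) le_v _] := outer_v _ _ i zp wu_u.
  have := lip_le _ _ _ zp yp' wu_u zy; rewrite ler_norml; lra.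
have [z [zp zy _ zl]] := clamp_box d_ge0 p_ge0 y2p' gap1 gap2.
have zi : z 0 i = p.2 0 i by apply: zl; rewrite y2i; lra.
have [_ /(_ zi) le_v] := outer_v _ _ i zp wu_u2.
have := lip_le _ _ _ zp y2p' wu_u2 zy; rewrite ler_norml; lra.
Qed.

Lemma enclosure_comparison (T : R)
    (gP gQ : R -> 'rV[R]_n * 'rV[R]_n -> 'rV[R]_n * 'rV[R]_n)
    (P Q : R -> 'rV[R]_n * 'rV[R]_n) :
  solution_on T gP P -> solution_on T gQ Q ->
  (forall t, 0 <= t <= T -> Tge0 (P t)) ->
  vle (P 0).1 (Q 0).1 -> vle (Q 0).2 (P 0).2 ->
  (forall t, 0 < t < T -> outer_velocity (P t) (gP t (P t))) ->
  (forall t, 0 < t < T -> inner_velocity (Q t) (gQ t (Q t))) ->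
  forall t, 0 <= t <= T -> vle (P t).1 (Q t).1 /\ vle (Q t).2 (P t).2.
Proof.
move=> [cont_P [SP dP]] [cont_Q [SQ dQ]] P_ge0 init1 init2 outerP innerQ.
have [BP BP_ge0 normP] := within_bounded cont_P.
have [BQ BQ_ge0 normQ] := within_bounded cont_Q.
(* One box bounds both curves at all times, so a single Lipschitz constant serves on the whole of
   [[0, T]]. *)
pose B := BP + BQ.
have [L L_ge0 lipL] := lipschitz_compact hf
  (compact_setX (@box_compact _ _ (const_mx (- B)) (const_mx B))
     (@box_compact _ _ wl wu)).
pose c1 (i : 'I_n) (p : 'rV[R]_n * 'rV[R]_n) : R := p.1 0 i.
pose c2 (i : 'I_n) (p : 'rV[R]_n * 'rV[R]_n) : R := p.2 0 i.
have c1_lin i : linear (c1 i) by move=> a x y; rewrite /c1 /= !mxE.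
have c2_lin i : linear (c2 i) by move=> a x y; rewrite /c2 /= !mxE.
have c1_cont i : continuous (c1 i).
  move=> x; apply: (@continuous_comp _ _ _ fst (fun v : 'rV[R]_n => v 0 i)).
    exact: cvg_fst.
  exact: coord_continuous.
have c2_cont i : continuous (c2 i).
  move=> x; apply: (@continuous_comp _ _ _ snd (fun v : 'rV[R]_n => v 0 i)).
    exact: cvg_snd.
  exact: coord_continuous.
(* Left indices stand for lower faces, right ones for upper faces; the signs make a gap positive
   when [Q] protrudes from [P]. Containment is then the nonpositivity of a finite family, ready for
   [le0_family]. *)
pose g (k : 'I_n + 'I_n) : R -> R := match k with
  | inl i => (c1 i \o P) - (c1 i \o Q) | inr i => (c2 i \o Q) - (c2 i \o P) end.
pose dg (k : 'I_n + 'I_n) (t : R) : R := match k with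
  | inl i => c1 i (gP t (P t)) - c1 i (gQ t (Q t))
  | inr i => c2 i (gQ t (Q t)) - c2 i (gP t (P t)) end.
have within_comp (c : 'rV[R]_n * 'rV[R]_n -> R) (X : R -> 'rV[R]_n * 'rV[R]_n) :
    continuous c -> {within `[0, T], continuous X} ->
    {within `[0, T], continuous (c \o X)}.
  by move=> cont_c cont_X t; apply: continuous_comp (cont_X t) (cont_c _).
have g_le0 : forall k t, 0 <= t <= T -> g k t <= 0.
  apply: (@le0_family R _ g dg T L (SP ++ SQ)) => //.
  - by case=> i s; apply: continuousB; exact: within_comp.
  - by case=> i; rewrite /g !fctE subr_le0; [exact: init1|exact: init2].
  - move=> k t tT; rewrite mem_cat negb_or.
    move=> /andP[/(dP _ tT) dPt /(dQ _ tT) dQt].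
    by case: k => i; apply: is_deriveB; exact: is_derive_linear.
  - move=> k t d tT _ g_le gk_gt0.
    have d_ge0 : 0 <= d by rewrite (le_trans (ltW gk_gt0)).
    have t0T : 0 <= t <= T by case/andP: tT => /ltW -> /ltW.
    have PB : `|P t| <= B by rewrite (le_trans (normP _ t0T))// lerDl.
    have QB : `|Q t| <= B by rewrite (le_trans (normQ _ t0T))// lerDr.
    have := gap_velocity_le lipL L_ge0 d_ge0 (P_ge0 _ t0T) (outerP _ tT)
      (innerQ _ tT) PB QB (fun i => g_le (inl i)) (fun i => g_le (inr i)).
    by case: k gk_gt0 => i gk_gt0 /(_ i)[]; auto.
move=> t tT; split=> i; rewrite -subr_le0.
  exact: (g_le0 (inl i)).
exact: (g_le0 (inr i)).
Qed.

End Comparison.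

(** * Velocities of the embedding systems and of a solution *)

Lemma set_minP (R : realType) (A : set R) : (exists2 m, A m & lbound A m) ->
  A (set_min A) /\ lbound A (set_min A).
Proof.
move=> [m Am mA].
exact: (@xgetPex _ 0 (A `&` lbound A) (ex_intro _ m (conj Am mA))).
Qed.

Lemma set_maxP (R : realType) (A : set R) : (exists2 m, A m & ubound A m) ->
  A (set_max A) /\ ubound A (set_max A).
Proof.
move=> [m Am mA].
exact: (@xgetPex _ 0 (A `&` ubound A) (ex_intro _ m (conj Am mA))).
Qed.

Section Fields.
Variables (R : realType) (n q : nat) (f : 'rV[R]_n -> 'rV[R]_q -> 'rV[R]_n).
Variables (wl wu : 'rV[R]_q).
Hypothesis wlu : vle wl wu.

(** A face times the disturbance box is nonempty and compact, so the continuous [f] attains its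
    extrema there. Extremality gives the outer property, attainment the inner one. *)
Lemma minmax_velocity (p : 'rV[R]_n * 'rV[R]_n) :
  [locally [lipschitz (f u.1 u.2) | u in [set: 'rV[R]_n * 'rV[R]_q]]] ->
  Tge0 p ->
  outer_velocity f wl wu p (minmax_embedding_field f wl wu p) /\
  inner_velocity f wl wu p (minmax_embedding_field f wl wu p).
Proof.
move=> /locally_lipschitz_continuous cont_f; case: p => p p' /= pp'.
have cont_fi i : continuous (fun u => f u.1 u.2 0 i).
  move=> x; apply: (@continuous_comp _ _ _ (fun u => f u.1 u.2)
    (fun v : 'rV[R]_n => v 0 i)); [exact: cont_f|exact: coord_continuous].
have wlP : box wl wu wl by split=> // j; exact: lexx.
have minP i :
    let A := [set y | exists z v,
      [/\ box p p' z, z 0 i = p 0 i, box wl wu v & y = f z v 0 i]] in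
    A (set_min A) /\ lbound A (set_min A).
  move=> A; apply: set_minP.
  (* The corner [p] lies on this face, which is therefore nonempty. *)
  have pP : box p (replace_entry p' i p) p.
    by apply/box_replace_r => //; split=> //; split=> // j; exact: lexx.
  have [[z u] /set_mem[/(box_replace_r _ _ pp')[zp zi] wu_u] zu_min] :=
    compact_EVT_min (ex_intro _ (p, wl) (conj pP wlP))
      (compact_setX (@box_compact _ _ p (replace_entry p' i p))
         (@box_compact _ _ wl wu)) (continuous_subspaceT (cont_fi i)).
  exists (f z u 0 i); first by exists z, u.
  move=> _ [z' [u' [z'p z'i wu_u' ->]]]; apply: (zu_min (z', u')).
  by apply/mem_set; split=> //; apply/box_replace_r.
have maxP i :
    let A := [set y | exists z v,
      [/\ box p p' z, z 0 i = p' 0 i, box wl wu v & y = f z v 0 i]] in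
    A (set_max A) /\ ubound A (set_max A).
  move=> A; apply: set_maxP.
  have pP : box (replace_entry p i p') p' p'.
    by apply/box_replace_l => //; split=> //; split=> // j; exact: lexx.
  have [[z u] /set_mem[/(box_replace_l _ _ pp')[zp zi] wu_u] zu_max] :=
    compact_EVT_max (ex_intro _ (p', wl) (conj pP wlP))
      (compact_setX (@box_compact _ _ (replace_entry p i p') p')
         (@box_compact _ _ wl wu)) (continuous_subspaceT (cont_fi i)).
  exists (f z u 0 i); first by exists z, u.
  move=> _ [z' [u' [z'p z'i wu_u' ->]]]; apply: (zu_max (z', u')).
  by apply/mem_set; split=> //; apply/box_replace_l.
split=> [z u i zp wu_u|i] /=; rewrite !mxE; split.
- by move=> zi; have [_] := minP i; apply; exists z, u.
- by move=> zi; have [_] := maxP i; apply; exists z, u.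
- have [[z [u [? ? ? yE]]] _] := minP i.
  by exists z, u; split; rewrite // -yE.
- have [[z [u [? ? ? yE]]] _] := maxP i.
  by exists z, u; split; rewrite // -yE.
Qed.

(** With the face regarded as a box, the inclusion property bounds every value of [f] on it. *)
Lemma embedding_outer_velocity
    (F : 'rV[R]_n * 'rV[R]_n -> 'rV[R]_q * 'rV[R]_q -> 'rV[R]_n * 'rV[R]_n)
    (p : 'rV[R]_n * 'rV[R]_n) :
  inclusion_function F f -> Tge0 p ->
  outer_velocity f wl wu p (embedding_field F wl wu p).
Proof.
case: p => p p' F_incl /= pp' z u i zp wu_u; rewrite !mxE /=; split=> zi.
  have zb : box p (replace_entry p' i p) z by apply/box_replace_r.
  (* The corners of the face are ordered because [z] lies between them. *)
  have ab : vle p (replace_entry p' i p).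
    by move=> j; apply: le_trans (zb.1 j) (zb.2 j).
  by have [le_f _] := F_incl _ _ _ _ ab wlu _ _ zb wu_u; exact: le_f.
have zb : box (replace_entry p i p') p' z by apply/box_replace_l.
have ab : vle (replace_entry p i p') p'.
  by move=> j; apply: le_trans (zb.1 j) (zb.2 j).
by have [_ f_le] := F_incl _ _ _ _ ab wlu _ _ zb wu_u; exact: f_le.
Qed.

(** Every face of the degenerate box is the point [x], so [x] and the current disturbance are the
    witnesses. *)
Lemma diagonal_inner_velocity (x : 'rV[R]_n) (w : 'rV[R]_q) :
  box wl wu w -> inner_velocity f wl wu (x, x) (f x w, f x w).
Proof.
move=> wB i; have xB : box x x x by split=> j; exact: lexx.
by split; exists x, w; split.
Qed.

Lemma diagonal_solution (T : R) (g : R -> 'rV[R]_n -> 'rV[R]_n)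
    (x : R -> 'rV[R]_n) :
  solution_on T g x ->
  solution_on T (fun s p => (g s p.1, g s p.1)) (fun s => (x s, x s)).
Proof.
have diag_cont : continuous (fun v : 'rV[R]_n => (v, v)).
  move=> v.
  exact: (@cvg_pair _ _ _ (nbhs v) (nbhs v) (nbhs v) _ _ _ id id cvg_id cvg_id).
move=> [cont_x [S dx]]; split.
  by move=> s; apply: continuous_comp (cont_x s) (diag_cont _).
exists S => t tT tS; have dxt := dx _ tT tS.
exact: (@is_derive_linear _ _ _ (fun v : 'rV[R]_n => (v, v))).
Qed.

End Fields.

(** * The two inclusions *)

Theorem proposition5 (R : realType) (n q : nat)
  (f : 'rV[R]_n -> 'rV[R]_q -> 'rV[R]_n)
  (hf : [locally [lipschitz (f u.1 u.2) | u in [set: 'rV[R]_n * 'rV[R]_q]]])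
  (wl wu : 'rV[R]_q) (hw : vle wl wu)
  (x0l x0u : 'rV[R]_n) (hx0 : vle x0l x0u)
  (F : 'rV[R]_n * 'rV[R]_n -> 'rV[R]_q * 'rV[R]_q -> 'rV[R]_n * 'rV[R]_n)
  (F_codom : forall p r, Tge0 p -> Tge0 r -> Tge0 (F p r))
  (hF : inclusion_function F f)
  (X : R -> 'rV[R]_n * 'rV[R]_n)
  (hX : trajectory (embedding_field F wl wu) (x0l, x0u) X)
  (X_ge0 : forall t, 0 <= t -> Tge0 (X t))
  (Xmin : R -> 'rV[R]_n * 'rV[R]_n)
  (hXmin : trajectory (minmax_embedding_field f wl wu) (x0l, x0u) Xmin)
  (Xmin_ge0 : forall t, 0 <= t -> Tge0 (Xmin t)) :
  forall t : R, 0 <= t ->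
    reachable f t (box x0l x0u) (box wl wu) `<=` box (Xmin t).1 (Xmin t).2 /\
    box (Xmin t).1 (Xmin t).2 `<=` box (X t).1 (X t).2.
Proof.
move=> t t_ge0; case: hX hXmin => X0 solX [Xmin0 solXmin].
have tt : 0 <= t <= t by rewrite t_ge0 lexx.
split.
  move=> _ [x [w [[x0_ge x0_le] _ w_box sol_x ->]]].
  (* The min-max trajectory is the outer curve, the solution doubled into a degenerate box the inner
     one. *)
  apply: (@enclosure_comparison R n q f wl wu hf t _ _ Xmin (fun s => (x s, x s))
    (solXmin t t_ge0) (diagonal_solution sol_x) _ _ _ _ _ t tt) => //=.
  - by move=> s /andP[s_ge0 _]; exact: Xmin_ge0.
  - by rewrite Xmin0.
  - by rewrite Xmin0.
  - move=> s /andP[s_gt0 _].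
    by have [] := minmax_velocity hw hf (Xmin_ge0 _ (ltW s_gt0)).
  - move=> s /andP[s_gt0 _]; apply: diagonal_inner_velocity.
    by apply: w_box; exact: ltW.
have [le1 le2] : vle (X t).1 (Xmin t).1 /\ vle (Xmin t).2 (X t).2.
  (* Here the min-max trajectory takes the inner role, with equal initial boxes. *)
  apply: (@enclosure_comparison R n q f wl wu hf t _ _ X Xmin
    (solX t t_ge0) (solXmin t t_ge0) _ _ _ _ _ t tt) => //=.
  - by move=> s /andP[s_ge0 _]; exact: X_ge0.
  - by rewrite Xmin0 X0 => i; exact: lexx.
  - by rewrite Xmin0 X0 => i; exact: lexx.
  - move=> s /andP[s_gt0 _].
    exact: embedding_outer_velocity (X_ge0 _ (ltW s_gt0)).
  - move=> s /andP[s_gt0 _].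
    by have [] := minmax_velocity hw hf (Xmin_ge0 _ (ltW s_gt0)).
move=> z [z_ge z_le]; split=> i.
  exact: le_trans (le1 i) (z_ge i).
exact: le_trans (z_le i) (le2 i).
Qed.
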